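(* Let $\sigma\in\mathrm{NC}_n$ and let $F$ be an indexed forest with $\mathrm{supp}(F)\subseteq[n]$. Then $\mathrm{ev}_\sigma(\mathfrak P_F)=0$ if and only if $\mathrm{ForToNC}(F)\not\le\sigma$ in the Bruhat order on $S_n$.
   Context: $\mathbf x=(x_1,x_2,\dots)$, $\mathbf t=(t_1,t_2,\dots)$; $\mathrm{ev}_\sigma f=f(t_{\sigma(1)},t_{\sigma(2)},\dots;\mathbf t)$ ($\sigma$ fixing integers $>n$). Noncrossing permutations: a set partition of $[n]$ is noncrossing if there are no distinct blocks $P,Q$ with $a,b\in P$, $c,d\in Q$, $a<c<b<d$; the associated permutation acts on each block $\{a_1<\dots<a_p\}$ by $a_j\mapsto a_{j-1}$ ($j\ge2$), $a_1\mapsto a_p$; $\mathrm{NC}_n$ is the set of these, and their cycles (including fixed points) are the blocks. A block $B$ is nested in a different block $C$ if there are $c,c'\in C$ with $c<\min B$ and $\max B<c'$. Indexed forests: sequences $F=(T_1,T_2,\dots)$ of binary plane trees (each node a leaf or an internal node with ordered left/right children), all but finitely many one-node trees; leaves identified with $\mathbb N$ left to right; $\emptyset$ has no internal nodes; $\mathrm{supp}(F)$ = leaves of trees containing an internal node. $\rho_F(v)$ is the leaf reached from internal node $v$ by going repeatedly to left children; terminal: both children leaves; $\mathrm{Qdes}(F)=\{\rho_F(v):v\text{ terminal}\}$; $F/i$ deletes the terminal node with $\rho_F(v)=i$ (replacing it and its leaves by one leaf, relabeling). The code of $F$ is $(c_i)_{i\ge1}$, $c_i=\#\{v:\rho_F(v)=i\}$,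 which determines $F$. $\mathrm{ForToNC}$ is the bijection from $\{F:\mathrm{supp}(F)\subseteq[n]\}$ to $\mathrm{NC}_n$ characterized by: $F=\mathrm{ForToNC}^{-1}(\sigma)$ has code given, for $i$ in the cycle $B$ of $\sigma$, by $c_i=|B|$ if $i=\min B$ and $B$ is nested in some other cycle, $c_i=|B|-1$ if $i=\min B$ and $B$ is nested in no other cycle, and $c_i=0$ otherwise. (Equivalently, $\mathrm{ForToNC}(F)$ is obtained by, for every internal node $v$ of $F$ that is a right child, deleting $v$, detaching its left subtree as a separate tree and attaching its right child to $v$'s parent in $v$'s place, and taking the noncrossing permutation whose blocks are the leaf sets of the resulting trees within $[n]$.) Double forest polynomials: $R_i^-f=f(x_1,\dots,x_{i-1},t_i,x_i,\dots;\mathbf t)$, $R_i^+f=f(x_1,\dots,x_i,t_i,x_{i+1},\dots;\mathbf t)$, $E_if=(R_i^+f-R_i^-f)/(x_i-t_i)$; $\mathfrak P_F$ is the unique homogeneous family ($\deg x_i=\deg t_i=1$) with $\mathfrak P_F(\mathbf t;\mathbf t)=\delta_{F,\emptyset}$ and $E_i\mathfrak P_F=\mathfrak P_{F/i}(\mathbf x;\widehat{\mathbf t}_i)$ if $i\in\mathrm{Qdes}(F)$, else $0$, $\widehat{\mathbf t}_i=(t_1,\dots,t_{i-1},t_{i+1},\dots)$. *)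

(* Defs.v *)
From HB Require Import structures.
From mathcomp Require Import all_boot all_order all_algebra all_fingroup.
From mathcomp Require Import mpoly.
From Stdlib Require Import Relations.
Set Implicit Arguments. Unset Strict Implicit. Unset Printing Implicit Defensive.
Import GRing.Theory.

(* Convention: indices are 0-based.  Paper index i >= 1 (variables x_i, t_i,
   leaves of forests) corresponds to index i-1 here, and [n] = {1..n}
   corresponds to 'I_n = {0..n-1}. *)

Inductive btree := Leaf | Node of btree & btree.

(* An indexed forest (T_1, T_2, ...) is represented by a finite list
   [T_1; ...; T_k]; all trees after the list are one-node trees (Leaf). *)
Definition forest := seq btree.

Fixpoint nleaves (T : btree) : nat :=
  match T with Leaf => 1 | Node l r => nleaves l + nleaves r end.

(* leftmost leaves of terminal internal nodes, leaves labelled from [off] *)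
Fixpoint tqdes (T : btree) (off : nat) : seq nat :=
  match T with
  | Leaf => [::]
  | Node Leaf Leaf => [:: off]
  | Node l r => tqdes l off ++ tqdes r (off + nleaves l)
  end.

Fixpoint tcode (T : btree) (off i : nat) : nat :=
  match T with
  | Leaf => 0
  | Node l r => ((off == i) : nat) + tcode l off i + tcode r (off + nleaves l) i
  end.

Fixpoint tcontract (T : btree) (off i : nat) : btree :=
  match T with
  | Leaf => Leaf
  | Node Leaf Leaf => if off == i then Leaf else T
  | Node l r => Node (tcontract l off i) (tcontract r (off + nleaves l) i)
  end.

Fixpoint fqdes (F : forest) (off : nat) : seq nat :=
  match F with
  | [::] => [::]
  | T :: F' => tqdes T off ++ fqdes F' (off + nleaves T)
  end.

Fixpoint fcode_from (F : forest) (off i : nat) : nat :=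
  match F with
  | [::] => 0
  | T :: F' => tcode T off i + fcode_from F' (off + nleaves T) i
  end.

Fixpoint fcontract_from (F : forest) (off i : nat) : forest :=
  match F with
  | [::] => [::]
  | T :: F' => tcontract T off i :: fcontract_from F' (off + nleaves T) i
  end.

Fixpoint fsupp_from (F : forest) (off : nat) : seq nat :=
  match F with
  | [::] => [::]
  | T :: F' =>
      (if T is Leaf then [::] else iota off (nleaves T)) ++ fsupp_from F' (off + nleaves T)
  end.

Definition Qdes (F : forest) : seq nat := fqdes F 0.
Definition fcontract (F : forest) (i : nat) : forest := fcontract_from F 0 i.
Definition fcode (F : forest) (i : nat) : nat := fcode_from F 0 i.
Definition supp (F : forest) : seq nat := fsupp_from F 0.
Definition forest_empty (F : forest) : bool :=
  all (fun T => if T is Leaf then true else false) F.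

(* a function of (x; t) in Q[x_1,x_2,...; t_1,t_2,...] *)
Definition pfun := (nat -> rat) -> (nat -> rat) -> rat.

Definition homog_poly (f : pfun) : Prop :=
  exists (N d : nat) (p : {mpoly rat[N + N]}),
    p \is d.-homog /\
    forall x t, f x t = p.@[fun k : 'I_(N + N) => if (k < N)%N then x k else t (k - N)%N].

Definition Rminus_arg (i : nat) (x t : nat -> rat) : nat -> rat :=
  fun j => if (j < i)%N then x j else if j == i then t i else x j.-1.
Definition Rplus_arg (i : nat) (x t : nat -> rat) : nat -> rat :=
  fun j => if (j <= i)%N then x j else if j == i.+1 then t i else x j.-1.

Definition Rminus (i : nat) (f : pfun) : pfun := fun x t => f (Rminus_arg i x t) t.
Definition Rplus (i : nat) (f : pfun) : pfun := fun x t => f (Rplus_arg i x t) t.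

Definition that (i : nat) (t : nat -> rat) : nat -> rat :=
  fun j => if (j < i)%N then t j else t j.+1.

(* P is the family of double forest polynomials: homogeneous polynomials,
   P_F(t;t) = delta_{F,empty}, and
   E_i P_F = (R_i^+ P_F - R_i^- P_F)/(x_i - t_i)
           = P_{F/i}(x; hat t_i) if i in Qdes F, and 0 otherwise. *)
Definition is_double_forest_family (P : forest -> pfun) : Prop :=
  [/\ forall F, homog_poly (P F),
      forall F t, P F t t = (if forest_empty F then 1 else 0)%R &
      forall F i x t,
        if i \in Qdes F then
          (Rplus i (P F) x t - Rminus i (P F) x t
           = (x i - t i) * P (fcontract F i) x (that i t))%R
        else Rplus i (P F) x t = Rminus i (P F) x t].

Definition ev {n : nat} (s : 'S_n) (f : pfun) : (nat -> rat) -> rat :=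
  fun t => f (fun j => if insub j is Some k then t (s k : nat) else t j) t.

Definition noncrossing {n : nat} (P : {set {set 'I_n}}) : Prop :=
  forall B C, B \in P -> C \in P -> B != C ->
    ~ exists a b c d : 'I_n,
        [/\ a \in B, b \in B, c \in C, d \in C &
            [&& (a < c)%N, (c < b)%N & (b < d)%N]].

(* y is the image of x under the permutation associated to the block B:
   a_j |-> a_{j-1} (j >= 2), a_1 |-> a_p *)
Definition nc_image {n : nat} (B : {set 'I_n}) (x y : 'I_n) : Prop :=
  y \in B /\
  (((y < x)%N /\ forall z, z \in B -> ~ ((y < z)%N /\ (z < x)%N)) \/
   ((forall z, z \in B -> (x <= z)%N) /\ (forall z, z \in B -> (z <= y)%N))).

Definition is_NC {n : nat} (s : 'S_n) : Prop :=
  exists P : {set {set 'I_n}},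
    [/\ partition P [set: 'I_n], noncrossing P &
        forall x, nc_image (pblock P x) x (s x)].

Definition nested {n : nat} (B C : {set 'I_n}) : bool :=
  [exists c in C, exists c' in C, [forall b in B, (c < b)%N && (b < c')%N]].

(* the code prescribed by ForToNC^{-1}(sigma) at i *)
Definition nc_code {n : nat} (s : 'S_n) (i : 'I_n) : nat :=
  let B := porbit s i in
  if [forall j in B, (i <= j)%N] then
    (if [exists C in porbits s, (C != B) && nested B C] then #|B| else #|B| - 1)
  else 0.

(* ForToNC(F) = tau  (for supp F in [n]), via the characterisation by codes *)
Definition ForToNC_is {n : nat} (F : forest) (tau : 'S_n) : Prop :=
  is_NC tau /\ forall i : 'I_n, fcode F i = nc_code tau i.

Definition perm_length {n : nat} (s : 'S_n) : nat :=
  #|[set p : 'I_n * 'I_n | (p.1 < p.2)%N && (s p.2 < s p.1)%N]|.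

Definition bruhat_step {n : nat} (u w : 'S_n) : Prop :=
  exists i j : 'I_n, [/\ i != j, w = (u * tperm i j)%g & perm_length u < perm_length w].

Definition bruhat_le {n : nat} : relation 'S_n := clos_refl_trans _ (@bruhat_step n).

(* Main.v *)
Require Import Defs.
From HB Require Import structures.
From mathcomp Require Import all_boot all_order all_algebra all_fingroup.
From mathcomp Require Import mpoly.
From mathcomp Require Import zify.
From Stdlib Require Import Relations.

Set Implicit Arguments.
Unset Strict Implicit.
Unset Printing Implicit Defensive.

Import Order.TTheory GRing.Theory Num.Theory.

(** Inserting a value [i] into a permutation [s] of [n] points, either as a fixed
    point or at position [i+1], gives two permutations of [n+1] points that form a
    Bruhat step. Every noncrossing permutation other than the identity is the higher
    member [ins_hi i s] of such a pair, with [s] noncrossing. The defining relation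
    of the double forest polynomials reads, at these points,
      ev_{hi} P_F = ev_{lo} P_F + (t_b - t_a) ev_s P_{F/i}(t without t_i),  a < b,
    where the last term is present only if [i] is in [Qdes F]. Hence all the
    evaluations are nonnegative when [t] increases, and their vanishing obeys a
    recursion. Under ForToNC, [i] is in [Qdes F] exactly when the permutation of [F]
    is also of the form [ins_hi i s'], and then [F/i] corresponds to [s']. It remains
    to see that the Bruhat order between noncrossing permutations obeys the same
    recursion; there it amounts to the pointwise order of Dyck paths, given by the
    numbers [gap] and [depth], which [ins_hi] and [ins_lo] change in a simple way. *)

(** * Codes of indexed forests *)

Lemma eq0_ngt0 m : ~ (0 < m) -> m = 0.
Proof. lia. Qed.

Lemma nleaves_gt0 T : 0 < nleaves T.
Proof. by elim: T => //= l IHl r IHr; rewrite addn_gt0 IHl. Qed.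

(** An internal node has at least two leaves below it, so its leftmost leaf is never the last leaf
    of the tree. *)
Lemma tcode_gt0_range T off i :
  0 < tcode T off i -> (off <= i) && (i.+1 < off + nleaves T).
Proof.
elim: T off => //= l IHl r IHr off.
have := nleaves_gt0 l; have := nleaves_gt0 r.
case: (posnP (tcode l off i)) => [->|/IHl]; last lia.
case: (posnP (tcode r (off + nleaves l) i)) => [->|/IHr]; last lia.
by case: eqP; lia.
Qed.

Lemma tcode_out T off i :
  (i < off) || (off + nleaves T <= i.+1) -> tcode T off i = 0.
Proof.
by move=> out; apply: eq0_ngt0 => /tcode_gt0_range; lia.
Qed.

Lemma tcode_shift T off i : tcode T off.+1 i.+1 = tcode T off i.
Proof. by elim: T off => //= l IHl r IHr off; rewrite eqSS IHl addSn IHr. Qed.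

Lemma tcode_root_eq0 T off : tcode T off off = 0 -> T = Leaf.
Proof. by case: T => //= l r; rewrite eqxx. Qed.

(** The nodes with leftmost leaf [i] form a chain of left children. The lowest one has a right child
    starting at leaf [i+1], so it is terminal exactly when no node has leftmost leaf [i+1]. *)
Lemma tqdesE T off i :
  (i \in tqdes T off) = (0 < tcode T off i) && (tcode T off i.+1 == 0).
Proof.
elim: T off => // l IHl r IHr off.
have nl := nleaves_gt0 l; have nr := nleaves_gt0 r.
have [[-> ->]|nLL] : (l = Leaf /\ r = Leaf) \/ ~ (l = Leaf /\ r = Leaf).
- by case: (l); case: (r); [left|right; case|right; case|right; case].
- by rewrite inE /= !addn0; case: eqP; case: eqP; lia.
have -> : (i \in tqdes (Node l r) off) =
          (i \in tqdes l off) || (i \in tqdes r (off + nleaves l)).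
  by rewrite -mem_cat; case: (l) (r) nLL => [|? ?] [|? ?] // [].
rewrite IHl IHr /=; set c := tcode l off i; set c' := tcode l off i.+1.
set d := tcode r _ i; set d' := tcode r _ i.+1.
have Hc := @tcode_gt0_range l off i; have Hc' := @tcode_gt0_range l off i.+1.
have Hd := @tcode_gt0_range r (off + nleaves l) i.
have Hd' := @tcode_gt0_range r (off + nleaves l) i.+1.
rewrite -/c -/c' -/d -/d' in Hc Hc' Hd Hd'.
case: (posnP c) Hc => [c0 _|c_gt0 /(_ isT) Hc] /=; last first.
  have d'0 : d' = 0 by apply: eq0_ngt0 => /Hd'; lia.
  have d0 : d = 0 by apply: eq0_ngt0 => /Hd; lia.
  by rewrite d0 d'0; lia.
case: (posnP d) Hd => [d0 _|d_gt0 /(_ isT) Hd] /=; last first.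
  have c'0 : c' = 0 by apply: eq0_ngt0 => /Hc'; lia.
  by rewrite c0 c'0; lia.
case: eqP => [ei|_]; last by rewrite c0 d0; lia.
(* the node itself has leftmost leaf i and no further node does: its left
   child is a leaf, so its right child starts at leaf i+1 and is a node *)
apply/esym/negbTE; move: nLL.
have lL : l = Leaf by apply: (@tcode_root_eq0 l off); rewrite -[RHS]c0 /c ei.
move=> nLL; apply/negP => /andP[_ /eqP z]; apply: nLL; split=> //.
apply: (@tcode_root_eq0 r i.+1).
by move: z; rewrite /d' lL ei /= addn1; lia.
Qed.

Lemma tcontract_notin T off i : i \notin tqdes T off -> tcontract T off i = T.
Proof.
elim: T off => // l IHl r IHr off.
have [[-> ->]|nLL] : (l = Leaf /\ r = Leaf) \/ ~ (l = Leaf /\ r = Leaf).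
- by case: (l); case: (r); [left|right; case|right; case|right; case].
- by rewrite inE /= eq_sym => /negbTE->.
move=> H.
have {H} : i \notin tqdes l off ++ tqdes r (off + nleaves l).
  by move: H; case: (l) (r) nLL => [|? ?] [|? ?] // [].
rewrite mem_cat => /norP[/IHl el /IHr er].
have -> : tcontract (Node l r) off i =
    Node (tcontract l off i) (tcontract r (off + nleaves l) i).
  by case: (l) (r) nLL => [|? ?] [|? ?] // [].
by rewrite el er.
Qed.

(** Contraction deletes leaf [i+1], whose entry is 0, and removes one node from the count at [i];
    [bump i.+1] skips the deleted entry. *)
Lemma tcontract_code T off i : i \in tqdes T off ->
  (nleaves (tcontract T off i)).+1 = nleaves T /\
  forall j, tcode (tcontract T off i) off j + (j == i)
            = tcode T off (bump i.+1 j).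
Proof.
elim: T off => // l IHl r IHr off.
have nl := nleaves_gt0 l; have nr := nleaves_gt0 r.
have [[-> ->]|nLL] : (l = Leaf /\ r = Leaf) \/ ~ (l = Leaf /\ r = Leaf).
- by case: (l); case: (r); [left|right; case|right; case|right; case].
- rewrite inE => /eqP->; rewrite /= eqxx; split=> // j.
  by rewrite /= /bump; case: eqP; case: eqP; lia.
have -> : (i \in tqdes (Node l r) off) =
          (i \in tqdes l off) || (i \in tqdes r (off + nleaves l)).
  by rewrite -mem_cat; case: (l) (r) nLL => [|? ?] [|? ?] // [].
have -> : tcontract (Node l r) off i =
    Node (tcontract l off i) (tcontract r (off + nleaves l) i).
  by case: (l) (r) nLL => [|? ?] [|? ?] // [].
case: (boolP (i \in tqdes l off)) => [il _|il /= ir].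
  have /tcode_gt0_range ri : 0 < tcode l off i by move: il; rewrite tqdesE => /andP[].
  rewrite (@tcontract_notin r); last first.
    rewrite tqdesE; apply/negP => /andP[/tcode_gt0_range]; lia.
  have [nE cE] := IHl _ il; split=> [|j] /=; first by rewrite -nE addSn.
  have -> : tcode r (off + nleaves (tcontract l off i)) j
            = tcode r (off + nleaves l) (bump i.+1 j).
    rewrite -nE addnS /bump; case: ltnP => ij; first by rewrite add1n tcode_shift.
    by rewrite !tcode_out //; lia.
  by rewrite -cE /bump; case: eqP; case: eqP; lia.
have /tcode_gt0_range ri : 0 < tcode r (off + nleaves l) i.
  by move: ir; rewrite tqdesE => /andP[].
rewrite (tcontract_notin il); have [nE cE] := IHr _ ir.
split=> [|j] /=; first by rewrite -nE addnS.
have -> : tcode l off (bump i.+1 j) = tcode l off j.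
  by rewrite /bump; case: ltnP => // ij; rewrite !tcode_out //; lia.
by rewrite -addnA cE /bump; case: eqP; case: eqP; lia.
Qed.

Lemma fcode_from_gt0_range F off i : 0 < fcode_from F off i -> off <= i.
Proof.
elim: F off => //= T F IH off; have := nleaves_gt0 T.
case: (posnP (tcode T off i)) => [->|/tcode_gt0_range]; last lia.
by move=> nT /IH; lia.
Qed.

Lemma fcode_from_shift F off i : fcode_from F off.+1 i.+1 = fcode_from F off i.
Proof. by elim: F off => //= T F IH off; rewrite tcode_shift addSn IH. Qed.

Lemma fqdesE F off i :
  (i \in fqdes F off) = (0 < fcode_from F off i) && (fcode_from F off i.+1 == 0).
Proof.
elim: F off => // T F IH off; have nT := nleaves_gt0 T.
rewrite /= mem_cat tqdesE IH.
have H := @tcode_gt0_range T off i; have H' := @tcode_gt0_range T off i.+1.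
have K := @fcode_from_gt0_range F (off + nleaves T) i.
have K' := @fcode_from_gt0_range F (off + nleaves T) i.+1.
move: (tcode T off i) (tcode T off i.+1) H H' => c c' H H'.
move: (fcode_from F _ i) (fcode_from F _ i.+1) K K' => d d' K K'.
case: (posnP c) H => [-> _|c_gt0 /(_ isT) H] /=.
  case: (posnP d) K => [_ _ //|d_gt0 /(_ isT) K] /=.
  by have -> : c' = 0 by apply: eq0_ngt0 => /H'; lia.
have -> : d = 0 by apply: eq0_ngt0 => /K; lia.
have -> : d' = 0 by apply: eq0_ngt0 => /K'; lia.
by lia.
Qed.

Lemma fcontract_from_notin F off i :
  i \notin fqdes F off -> fcontract_from F off i = F.
Proof.
elim: F off => //= T F IH off; rewrite mem_cat => /norP[iT /IH->].
by rewrite tcontract_notin.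
Qed.

Lemma fcontract_from_code F off i j : i \in fqdes F off ->
  fcode_from (fcontract_from F off i) off j + (j == i)
  = fcode_from F off (bump i.+1 j).
Proof.
elim: F off => // T F IH off; have nT := nleaves_gt0 T.
rewrite /= mem_cat.
case: (boolP (i \in tqdes T off)) => [iT _|iT /= iF].
  have /tcode_gt0_range ri : 0 < tcode T off i by move: iT; rewrite tqdesE => /andP[].
  rewrite fcontract_from_notin; last first.
    rewrite fqdesE; apply/negP => /andP[/fcode_from_gt0_range]; lia.
  have [nE cE] := tcontract_code iT.
  rewrite addnAC cE; congr (_ + _); rewrite -nE addnS /bump.
  case: ltnP => ij; first by rewrite add1n fcode_from_shift.
  by rewrite [LHS]eq0_ngt0 1?[RHS]eq0_ngt0 // => /fcode_from_gt0_range; lia.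
have /fcode_from_gt0_range ri : 0 < fcode_from F (off + nleaves T) i.
  by move: iF; rewrite fqdesE => /andP[].
rewrite (tcontract_notin iT) -addnA IH //; congr (_ + _).
by rewrite /bump; case: ltnP => // ij; rewrite !tcode_out //; lia.
Qed.

Lemma QdesE F i : (i \in Qdes F) = (0 < fcode F i) && (fcode F i.+1 == 0).
Proof. exact: fqdesE. Qed.

Lemma fcontract_code F i j : i \in Qdes F ->
  fcode (fcontract F i) j + (j == i) = fcode F (bump i.+1 j).
Proof. exact: fcontract_from_code. Qed.

Lemma fcode_supp F i : 0 < fcode F i -> i \in supp F.
Proof.
rewrite /fcode /supp; move: {2 3}0 => off; elim: F off => //= T F IH off.
rewrite mem_cat; case: (posnP (tcode T off i)) => [->|].
  by rewrite add0n => /IH H; rewrite H orbT.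
by case: T => // l r /tcode_gt0_range lt_i _; rewrite mem_iota; lia.
Qed.

Lemma forest_emptyP F : reflect (forall i, fcode F i = 0) (forest_empty F).
Proof.
have H off : reflect (forall i, fcode_from F off i = 0) (forest_empty F).
  elim: F off => [|[|l r] F IH] off /=; first by left.
  - exact: IH.
  - by right=> /(_ off); rewrite eqxx.
exact: H.
Qed.

(** * Rank numbers and the Bruhat order *)

Definition rank n (s : 'S_n) (p q : nat) : nat :=
  \sum_(a < n) ((a < p) && (q <= s a)).

Lemma rank_lift n (p q : 'I_n.+1) (s : 'S_n) a b :
  rank (lift_perm p q s) a b
  = rank s (unbump p a) (unbump q b) + ((p < a) && (b <= q)).
Proof.
rewrite /rank (bigD1_ord p) //= lift_perm_id addnC; congr (_ + _).
apply: eq_bigr => k _; rewrite lift_perm_lift /=; congr (nat_of_bool _).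
by rewrite /bump /unbump; lia.
Qed.

Lemma rank_recl n (s : 'S_n) (k : 'I_n) q :
  rank s k.+1 q = rank s k q + (q <= s k).
Proof.
rewrite /rank (bigD1 k) //= [in RHS](bigD1 k) //= ltnSn ltnn /= add0n addnC.
congr (_ + _); apply: eq_bigr => a ak; congr (nat_of_bool (_ && _)).
by rewrite ltnS leq_eqVlt (inj_eq val_inj) (negbTE ak).
Qed.

Lemma rank_recr n (s : 'S_n) (k : 'I_n) p :
  rank s p k = rank s p k.+1 + ((s^-1)%g k < p).
Proof.
have e : ((s^-1)%g k < p) = \sum_(a < n) ((a < p) && (s a == k)) :> nat.
  rewrite (bigD1 ((s^-1)%g k)) //= permKV eqxx andbT big1 ?addn0 // => a ak.
  rewrite (_ : s a == k = false) ?andbF //.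
  by apply: contraNF ak => /eqP <-; rewrite permK.
rewrite e /rank -big_split /=; apply: eq_bigr => a _.
by rewrite -(inj_eq val_inj) /=; lia.
Qed.

(** Only the positions [a] and [b] contribute differently, and the swap moves the larger value to
    the earlier position. *)
Lemma rank_tperm n (s : 'S_n) (a b : 'I_n) p q :
  a < b -> s a < s b -> rank s p q <= rank (tperm a b * s)%g p q.
Proof.
move=> ab sab; have ba : b != a by rewrite neq_ltn ab orbT.
rewrite /rank (bigD1 a) //= [X in _ <= X](bigD1 a) //=.
rewrite (bigD1 b) //= [X in _ <= _ + X](bigD1 b) //=.
rewrite !permM tpermL tpermR !addnA; apply: leq_add; first by lia.
rewrite leq_eqVlt; apply/orP; left; apply/eqP; apply: eq_bigr => x /andP[xa xb].
by rewrite permM tpermD // eq_sym.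
Qed.

Lemma mulg_tperm n (s : 'S_n) (a b : 'I_n) :
  (s * tperm (s a) (s b) = tperm a b * s)%g.
Proof.
by apply/permP => x; rewrite !permM inj_tperm //; apply: perm_inj.
Qed.

(* Swapping positions a and b injects the inversions lost into the inversions
   gained, and misses the gained inversion (a, b). *)
Lemma perm_length_tperm n (s : 'S_n) (a b : 'I_n) :
  a < b -> s a < s b -> perm_length s < perm_length (tperm a b * s)%g.
Proof.
move=> ab sab; rewrite /perm_length; set w := (tperm a b * s)%g.
set I := [set _ | _]; set J := [set _ | _].
rewrite -(cardsID J I) -(cardsID I J) [J :&: I]setIC ltn_add2l.
pose f (x : 'I_n * 'I_n) := (tperm a b x.1, tperm a b x.2).
have f_inj : injective f by move=> [x y] [x' y'] [/perm_inj-> /perm_inj->].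
rewrite -(card_imset _ f_inj); apply: proper_card; apply/properP; split.
  apply/subsetP => _ /imsetP[[x y] xyI ->].
  move: xyI; rewrite !inE /f /w !permM !tpermK /=.
  case: tpermP => [->|->|xa xb]; case: tpermP => [->|->|ya yb]; lia.
exists (a, b).
  by rewrite !inE /w !permM tpermL tpermR /=; lia.
apply/imsetP => -[[x y]]; rewrite !inE /f /= => xyI [ea eb].
have ex : x = b by rewrite -(tpermK a b x) -ea tpermL.
have ey : y = a by rewrite -(tpermK a b y) -eb tpermR.
by move: xyI; rewrite ex ey; lia.
Qed.

Lemma bruhat_step_tperm n (s : 'S_n) (a b : 'I_n) :
  a < b -> s a < s b -> bruhat_step s (tperm a b * s)%g.
Proof.
move=> ab sab; exists (s a), (s b); split; last exact: perm_length_tperm.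
- by rewrite neq_ltn sab.
- by rewrite mulg_tperm.
Qed.

(** This passes from exchanging values to exchanging positions. A descent cannot have been
    exchanged, since that would shorten the permutation. *)
Lemma bruhat_stepP n (s w : 'S_n) : bruhat_step s w ->
  exists a b : 'I_n, [/\ a < b, s a < s b & w = (tperm a b * s)%g].
Proof.
case=> i [j [ij -> len]].
rewrite -(permKV s i) -(permKV s j) mulg_tperm in len *.
move: ((s^-1)%g i) ((s^-1)%g j) (permKV s i) (permKV s j) len => a b ei ej.
wlog ab : i j a b ij ei ej / a < b => [wl|len].
  have [|ab|/val_inj e] := ltngtP a b; first exact: (wl i j).
    by rewrite tpermC; apply: (wl j i) => //; rewrite eq_sym.
  by case/eqP: ij; rewrite -ei -ej e.
exists a, b; split=> //; have [//|sba|/val_inj/perm_inj e] := ltngtP (s a) (s b).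
  have := @perm_length_tperm n (tperm a b * s)%g a b ab.
  by rewrite !permM tpermL tpermR mulgA tperm2 mul1g => /(_ sba) /(ltn_trans len); rewrite ltnn.
by move: ab; rewrite e ltnn.
Qed.

Lemma bruhat_rank n (s w : 'S_n) p q : bruhat_le s w -> rank s p q <= rank w p q.
Proof.
elim=> [u v /bruhat_stepP[a [b [ab sab ->]]]|//|u v x _ uv _].
- exact: rank_tperm.
- exact: leq_trans.
Qed.

Lemma lift_perm_tperm n (q : 'I_n.+1) (a b : 'I_n) :
  lift_perm q q (tperm a b) = tperm (lift q a) (lift q b).
Proof.
apply/permP => x; case: (unliftP q x) => [y|] ->.
  by rewrite lift_perm_lift inj_tperm //; apply: lift_inj.
by rewrite lift_perm_id tpermD // eq_sym neq_lift.
Qed.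

Lemma bruhat_lift n (p q : 'I_n.+1) (s w : 'S_n) :
  bruhat_le s w -> bruhat_le (lift_perm p q s) (lift_perm p q w).
Proof.
elim=> [u v /bruhat_stepP[a [b [ab sab ->]]]|u|u v x _ uv _]; last 2 first.
- exact: rt_refl.
- exact: rt_trans.
apply: rt_step; rewrite -(lift_permM p p q) lift_perm_tperm.
apply: bruhat_step_tperm; last rewrite !lift_perm_lift.
all: by rewrite /= /bump; lia.
Qed.

Lemma perm_le_id n (s : 'S_n) : (forall x, s x <= x) -> s = 1%g.
Proof.
move=> le_s; apply/permP => x; rewrite perm1.
have [m] := ubnP (x : nat); elim: m x => // m IH x; rewrite ltnS => xm.
have := le_s x; rewrite leq_eqVlt => /orP[/eqP/val_inj //|lt].
by have /perm_inj := IH (s x) (leq_trans lt xm).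
Qed.

Lemma perm_ge_id n (s : 'S_n) : (forall x : 'I_n, x <= s x) -> s = 1%g.
Proof.
move=> ge_s; apply: invg_inj; rewrite invg1; apply: perm_le_id => x.
by rewrite -{2}(permKV s x).
Qed.

(** * Noncrossing permutations and insertions *)

(* The arcs [x -> s x] cut out stable intervals: the open interval below a
   descending arc, and the closed interval spanned by a block (from its minimum
   [x] to its maximum [s x]). *)
Definition noncrossing_perm n (s : 'S_n) : Prop :=
  (forall x y : 'I_n, s x < y -> y < x -> s x < s y < x) /\
  (forall x y : 'I_n, x <= y -> y <= s x -> x <= s y <= s x).

(** Since [s y] lies in the block of [y], an arc from [y] leaving the interval attached to [x] would
    yield four crossing points. *)
Lemma is_NC_noncrossing_perm n (s : 'S_n) : is_NC s -> noncrossing_perm s.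
Proof.
case=> P [partP ncP imP].
have [/eqP covP trivP _] := and3P partP.
have inP x : pblock P x \in P by rewrite pblock_mem // covP inE.
have memP x : x \in pblock P x by rewrite mem_pblock covP inE.
have sP x : s x \in pblock P x by case: (imP x).
have same x y : y \in pblock P x -> pblock P y = pblock P x by apply: same_pblock.
have nc := fun x y => ncP _ _ (inP x) (inP y).
split=> x y.
  move=> sxy yx; case: (imP x) => _ [[_ gap]|[mn _]]; last first.
    by have := mn _ (sP x); lia.
  have yx_neq : pblock P y != pblock P x.
    by apply/eqP => e; apply: (gap y); rewrite -?e.
  have sneq z : z \in pblock P x -> s y != z.
    move=> zx; apply: contraNneq yx_neq => e.
    by rewrite -(same _ _ (sP y)) e (same _ _ zx).
  have := sneq _ (memP x); have := sneq _ (sP x); rewrite -!(inj_eq val_inj) /= => n1 n2.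
  apply/andP; split; rewrite ltnNge; apply/negP => le.
    apply: (nc _ _ yx_neq); exists (s y), y, (s x), x.
    by split=> //; lia.
  rewrite eq_sym in yx_neq; apply: (nc _ _ yx_neq); exists (s x), x, y, (s y).
  by split=> //; lia.
move=> xy ysx; case: (imP x) => _ [[lt _]|[mn mx]]; first lia.
have [yx|yx_neq] := eqVneq (pblock P y) (pblock P x).
  by rewrite mn ?mx // -yx.
have sneq z : z \in pblock P x -> s y != z.
  move=> zx; apply: contraNneq yx_neq => e.
  by rewrite -(same _ _ (sP y)) e (same _ _ zx).
have yneq z : z \in pblock P x -> y != z.
  by move=> zx; apply: contraNneq yx_neq => ->; rewrite (same _ _ zx).
have := sneq _ (memP x); have := sneq _ (sP x).
have := yneq _ (memP x); have := yneq _ (sP x).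
rewrite -!(inj_eq val_inj) /= => n1 n2 n3 n4.
apply/andP; split; rewrite leqNgt; apply/negP => lt.
  apply: (nc _ _ yx_neq); exists (s y), y, x, (s x).
  by split=> //; lia.
rewrite eq_sym in yx_neq; apply: (nc _ _ yx_neq); exists x, (s x), y, (s y).
by split=> //; lia.
Qed.

(* [ins true i s] doubles the point [i] of [s] (the new point [i+1] is sent to
   [i]), while [ins false i s] inserts a new fixed point at [i]. *)
Definition ins_pos (b : bool) n (i : 'I_n) : 'I_n.+1 :=
  if b then lift ord0 i else widen_ord (leqnSn n) i.

Definition ins (b : bool) n (i : 'I_n) (s : 'S_n) : 'S_n.+1 :=
  lift_perm (ins_pos b i) (ins_pos false i) s.

Lemma ins_posE b n (i : 'I_n) : ins_pos b i = i + b :> nat.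
Proof. by case: b; rewrite /= ?addn1 ?addn0. Qed.

Lemma lift_ins_posE b n (i x : 'I_n) : lift (ins_pos b i) x = bump (i + b) x :> nat.
Proof. by rewrite /= ins_posE. Qed.

Lemma ins_at b n (i : 'I_n) s : ins b i s (ins_pos b i) = i :> nat.
Proof. by rewrite lift_perm_id. Qed.

Lemma ins_lift b n (i x : 'I_n) s : ins b i s (lift (ins_pos b i) x) = bump i (s x) :> nat.
Proof. by rewrite lift_perm_lift. Qed.

Lemma lift_ins_pos b n (i : 'I_n) : lift (ins_pos b i) i = ins_pos (~~ b) i.
Proof. by apply: val_inj; rewrite /= !ins_posE /bump; case: b => /=; lia. Qed.

Lemma ins_atN b n (i : 'I_n) s : ins b i s (ins_pos (~~ b) i) = bump i (s i) :> nat.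
Proof. by rewrite -lift_ins_pos ins_lift. Qed.

Lemma noncrossing_ins b n (i : 'I_n) (s : 'S_n) :
  noncrossing_perm (ins b i s) <-> noncrossing_perm s.
Proof.
split=> -[H1 H2]; split=> x y.
- have := H1 (lift (ins_pos b i) x) (lift (ins_pos b i) y).
  by rewrite !ins_lift !lift_ins_posE /bump; case: b {H1 H2}; lia.
- have := H2 (lift (ins_pos b i) x) (lift (ins_pos b i) y).
  by rewrite !ins_lift !lift_ins_posE /bump; case: b {H1 H2}; lia.
- case: (unliftP (ins_pos b i) x) => [x'|] ->;
    case: (unliftP (ins_pos b i) y) => [y'|] ->;
    rewrite ?ins_lift ?lift_ins_posE ?ins_at ?ins_posE /bump.
  + by have := H1 x' y'; case: b {H1 H2}; lia.
  + by case: b {H1 H2}; lia.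
  + by case: b {H1 H2}; lia.
  + by case: b {H1 H2}; lia.
- case: (unliftP (ins_pos b i) x) => [x'|] ->;
    case: (unliftP (ins_pos b i) y) => [y'|] ->;
    rewrite ?ins_lift ?lift_ins_posE ?ins_at ?ins_posE /bump.
  + by have := H2 x' y'; case: b {H1 H2}; lia.
  + by case: b {H1 H2}; lia.
  + by case: b {H1 H2}; lia.
  + by case: b {H1 H2}; lia.
Qed.

Lemma perm_unlift n (s : 'S_n.+1) (p q : 'I_n.+1) :
  s p = q -> exists s', s = lift_perm p q s'.
Proof.
move=> spq.
have ex k : {k' | s (lift p k) = lift q k'}.
  case: (unliftP q (s (lift p k))) => [k' ->|]; first by exists k'.
  by rewrite -spq => /perm_inj/eqP; rewrite eq_sym (negbTE (neq_lift p k)).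
have f_inj : injective (fun k => sval (ex k)).
  move=> k l; case: (ex k) (ex l) => [k' ek] [l' el] /= e.
  by apply/(@lift_inj _ p)/(@perm_inj _ s); rewrite ek el e.
exists (perm f_inj); apply/permP => x; case: (unliftP p x) => [y|] ->.
  by rewrite lift_perm_lift permE; case: (ex y).
by rewrite lift_perm_id.
Qed.

Lemma perm_unins b n (i : 'I_n) (s : 'S_n.+1) :
  s (ins_pos b i) = i :> nat -> exists s', s = ins b i s'.
Proof. by move=> e; apply: perm_unlift; apply: val_inj. Qed.

Lemma ins_tperm b n (i : 'I_n) (s : 'S_n) :
  ins b i s = (tperm (ins_pos false i) (ins_pos true i) * ins (~~ b) i s)%g.
Proof.
have posN := lift_ins_pos b i; have := lift_ins_pos (~~ b) i; rewrite negbK => posN'.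
have -> : tperm (ins_pos false i) (ins_pos true i) = tperm (ins_pos b i) (ins_pos (~~ b) i).
  by case: b {posN posN'} => //; rewrite tpermC.
apply/permP => x; rewrite permM; case: tpermP => [->|->|xb xnb].
- by rewrite /ins !lift_perm_id.
- by rewrite -{1}posN -[in RHS]posN' /ins !lift_perm_lift.
case: (unliftP (ins_pos b i) x) => [y|] // exy.
have yi : y <> i by move=> e; apply: xnb; rewrite exy e posN.
have exy' : x = lift (ins_pos (~~ b) i) y.
  apply: val_inj; have /eqP := yi; rewrite -(inj_eq val_inj) exy /= !ins_posE /bump.
  by case: b {exy xb xnb posN posN'} => /=; lia.
by rewrite {1}exy exy' /ins !lift_perm_lift.
Qed.

(* The higher and the lower of the two insertions, in the Bruhat order. *)
Definition ins_hi n (i : 'I_n) (s : 'S_n) := ins (i <= s i) i s.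
Definition ins_lo n (i : 'I_n) (s : 'S_n) := ins (~~ (i <= s i)) i s.

Lemma bruhat_step_ins n (i : 'I_n) (s : 'S_n) : bruhat_step (ins_lo i s) (ins_hi i s).
Proof.
rewrite /ins_hi ins_tperm; apply: bruhat_step_tperm; first by rewrite !ins_posE; lia.
rewrite /ins_lo; set b := (i <= s i).
have h1 := ins_at (~~ b) i s; have h2 := ins_atN (~~ b) i s.
rewrite negbK /bump in h2; move: h1 h2; rewrite /b.
by case: (leqP i (s i)) => /= le ->; move=> ->; lia.
Qed.

(** If [i+1] is sent to [i], it is a doubled point. Otherwise the descending arc from [i+1] passes
    over [i], and noncrossing keeps the image of [i] below [i+1], so [i] is a fixed point. *)
Lemma ins_hiP n (i : 'I_n) (s : 'S_n.+1) :
  noncrossing_perm s ->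
  i <= s (ins_pos false i) -> s (ins_pos true i) <= i ->
  exists2 s', s = ins_hi i s' & noncrossing_perm s'.
Proof.
move=> nc le0 le1.
suff [b [s' [es hs]]] : exists b s', s = ins b i s' /\ (i <= s' i) = b.
  exists s'; first by rewrite /ins_hi hs.
  by move: nc; rewrite es => /noncrossing_ins.
have n01 : s (ins_pos false i) <> s (ins_pos true i).
  by move/perm_inj => /(congr1 (@nat_of_ord _)); rewrite !ins_posE /=; lia.
move: le1; rewrite leq_eqVlt => /orP[/eqP e1|lt1].
  have [s' es] := perm_unins e1; exists true, s'; split=> //.
  have n0 : s (ins_pos false i) != i :> nat.
    by apply/eqP => e0; apply: n01; apply: val_inj; rewrite /= e0 e1.
  have := ins_atN true i s'; rewrite -es [~~ _]/= /bump; lia.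
have e0 : s (ins_pos false i) = i :> nat.
  case: nc => [H1 _]; have := H1 (ins_pos true i) (ins_pos false i).
  by rewrite !ins_posE; lia.
have [s' es] := perm_unins e0; exists false, s'; split=> //.
have := ins_atN false i s'; rewrite -es [~~ _]/= /bump; lia.
Qed.

(** The least [x] with [s x < x] is preceded by a point that does not descend, so [ins_hiP] applies
    with [i = x-1]. *)
Lemma noncrossing_ins_hi n (s : 'S_n.+1) : noncrossing_perm s -> s != 1%g ->
  exists i s', s = ins_hi i s' /\ noncrossing_perm s'.
Proof.
move=> nc s1.
have [/existsP[x0 x0P]|/existsPn ge] := boolP [exists x, s x < x]; last first.
  by case/eqP: s1; apply: perm_ge_id => x; rewrite leqNgt ge.
have := @arg_minnP _ x0 (fun x => s x < x) (fun x => x) x0P; case=> x sx mn.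
have x_gt0 : 0 < x by lia.
have lt_i : x.-1 < n by have := ltn_ord x; lia.
pose i := Ordinal lt_i.
have ex : x = ins_pos true i by apply: val_inj; rewrite /= /bump /=; lia.
have [||s' -> ncs'] := @ins_hiP _ i _ nc; last by exists i, s'.
  rewrite leqNgt; apply/negP => lt.
  by have := mn (ins_pos false i); rewrite ex !ins_posE addn0; lia.
by rewrite -ex /=; lia.
Qed.

(** * Depth profiles *)

(* For a noncrossing permutation, [gap s k] counts the blocks straddling the gap
   between [k-1] and [k], and [depth s k] the blocks whose convex hull contains
   [k]. Interleaved, these numbers form the Dyck path of [s]. *)
Definition gap n (s : 'S_n) k := rank s k k.
Definition depth n (s : 'S_n) k := rank s k.+1 k.

Definition dominated n (t s : 'S_n) : bool :=
  [forall k : 'I_n, (depth t k <= depth s k) && (gap t k <= gap s k)].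

Lemma rank_ge n (s : 'S_n) p q : n <= q -> rank s p q = 0.
Proof.
by move=> nq; apply: big1 => a _; rewrite [q <= _]leqNgt (leq_trans _ nq) ?andbF.
Qed.

Lemma dominatedP n (t s : 'S_n) :
  reflect (forall k, depth t k <= depth s k /\ gap t k <= gap s k) (dominated t s).
Proof.
apply: (iffP forallP) => H k; last by apply/andP; apply: H.
have [kn|nk] := ltnP k n; first by apply/andP; apply: (H (Ordinal kn)).
by rewrite /depth /gap !rank_ge.
Qed.

Lemma bruhat_dominated n (t s : 'S_n) : bruhat_le t s -> dominated t s.
Proof. by move=> ts; apply/dominatedP => k; split; apply: bruhat_rank. Qed.

Lemma dominated_trans n (s t u : 'S_n) : dominated t s -> dominated s u -> dominated t u.
Proof.
move=> /dominatedP ts /dominatedP su; apply/dominatedP => k.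
by have := ts k; have := su k; lia.
Qed.

Lemma dominated1 n (t : 'S_n) : dominated t 1%g -> t = 1%g.
Proof.
move=> /dominatedP H; apply: perm_le_id => a; rewrite leqNgt; apply/negP => lt.
have [_] := H a.+1; rewrite leqNgt => /negP; apply.
rewrite /gap /rank [X in X < _]big1 => [|x _]; last by rewrite perm1; lia.
by rewrite (bigD1 a) //= ltnSn lt.
Qed.

Lemma depthE n (s : 'S_n) (k : 'I_n) : depth s k = gap s k + (k <= s k).
Proof. exact: rank_recl. Qed.

(** Let [g] and [d] be the gap and the depth of [s] at [i]. In the interleaved sequence the segment
    [g, d] becomes [g, g+1, d, d]. *)
Lemma gap_ins_hi n (i : 'I_n) (s : 'S_n) k : gap (ins_hi i s) k =
  if k <= i then gap s k else if k == i.+1 then depth s i else gap s k.-1.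
Proof.
rewrite /ins_hi /gap rank_lift !ins_posE.
rewrite [X in _ + X](_ : _ = 0) ?addn0; last by case: (i <= s i); lia.
case: ifP => ki; first by congr (rank s _ _); rewrite /unbump; lia.
case: ifP => [/eqP->|ki1]; last by congr (rank s _ _); rewrite /unbump; lia.
have -> : unbump i i.+1 = i by rewrite /unbump; lia.
have := depthE s i; rewrite /depth /gap; case: (i <= s i) => /= H.
  by congr (rank s _ _); rewrite /unbump; lia.
by rewrite [RHS]H [RHS]addn0; congr (rank s _ _); rewrite /unbump; lia.
Qed.

Lemma depth_ins_hi n (i : 'I_n) (s : 'S_n) k : depth (ins_hi i s) k =
  if k < i then depth s k else if k == i then (gap s i).+1 else depth s k.-1.
Proof.
rewrite /ins_hi /depth rank_lift !ins_posE.
case: ifP => ki.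
  rewrite [X in _ + X](_ : _ = 0) ?addn0; last by case: (i <= s i); lia.
  by congr (rank s _ _); rewrite /unbump; lia.
case: ifP => [/eqP->|ki1]; last first.
  rewrite [X in _ + X](_ : _ = 0) ?addn0; last by case: (i <= s i); lia.
  by congr (rank s _ _); rewrite /unbump; lia.
have -> : unbump (i + false) i = i by rewrite /unbump; lia.
have := depthE s i; rewrite /depth /gap; case: (i <= s i) => /= H.
  have -> : unbump (i + 1) i.+1 = i.+1 by rewrite /unbump; lia.
  by rewrite H; lia.
have -> : unbump (i + 0) i.+1 = i by rewrite /unbump; lia.
by lia.
Qed.

(** Here the segment [g, d] becomes [g, d, g, d], so the two insertions can differ only in the
    middle two entries. *)
Lemma gap_ins_lo n (i : 'I_n) (s : 'S_n) k : gap (ins_lo i s) k =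
  if k <= i then gap s k else gap s k.-1.
Proof.
rewrite /ins_lo /gap rank_lift !ins_posE.
rewrite [X in _ + X](_ : _ = 0) ?addn0; last by case: (i <= s i); lia.
case: ifP => ki; first by congr (rank s _ _); rewrite /unbump; lia.
have [ki1|ki1] := eqVneq k i.+1; last by congr (rank s _ _); rewrite /unbump; lia.
have := depthE s i; rewrite /depth /gap ki1 /=.
have -> : unbump i i.+1 = i by rewrite /unbump; lia.
case: (i <= s i) => /= H.
  by congr (rank s _ _); rewrite /unbump; lia.
have -> : unbump (i + 1) i.+1 = i.+1 by rewrite /unbump; lia.
by rewrite H; lia.
Qed.

Lemma depth_ins_lo n (i : 'I_n) (s : 'S_n) k : depth (ins_lo i s) k =
  if k <= i then depth s k else depth s k.-1.
Proof.
rewrite /ins_lo /depth rank_lift !ins_posE.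
have := depthE s i; rewrite /depth /gap; case: (i <= s i) => /= H.
  have [e|ki1] := eqVneq k i; last first.
    rewrite [X in _ + X](_ : _ = 0) ?addn0; last by lia.
    by case: ifP => ki; congr (rank s _ _); rewrite /unbump; lia.
  rewrite e leqnn H; congr (rank s _ _ + _); rewrite /unbump; lia.
rewrite [X in _ + X](_ : _ = 0) ?addn0; last by lia.
case: ifP => ki; congr (rank s _ _); rewrite /unbump; lia.
Qed.

(** The old entries all reappear, and the additional ones are monotone in them. *)
Lemma dominated_ins_hi n (i : 'I_n) (t s : 'S_n) :
  dominated (ins_hi i t) (ins_hi i s) = dominated t s.
Proof.
apply/dominatedP/dominatedP => H k.
- have [ki|ki|ki] := ltngtP k i.
  + by have := H k; rewrite !gap_ins_hi !depth_ins_hi ki (ltnW ki).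
  + have := H k.+1; rewrite !gap_ins_hi !depth_ins_hi /= eqSS.
    by rewrite !ltnNge (ltnW ki) (leqW (ltnW ki)) /= !gtn_eqF //=; lia.
  + have := H i; have := H i.+1; rewrite !gap_ins_hi !depth_ins_hi ki.
    by rewrite ltnn leqnn !eqxx ltnNge leqnSn /= gtn_eqF //; lia.
- rewrite !gap_ins_hi !depth_ins_hi.
  have := H k; have := H i; have := H k.-1.
  by case: ltngtP => ki; case: (eqVneq k i.+1); lia.
Qed.

(** When exactly one of the two profiles rises at [i], domination gives the sharper bounds
    [gap t i + 1 <= depth s i] and [depth t i <= gap s i]. *)
Lemma dominated_ins_hi_lo n (i : 'I_n) (t s : 'S_n) :
  (i <= t i) != (i <= s i) -> dominated t s -> dominated (ins_hi i t) (ins_lo i s).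
Proof.
move=> bts /dominatedP H; apply/dominatedP => k.
rewrite gap_ins_hi depth_ins_hi gap_ins_lo depth_ins_lo.
have := H k; have := H i; have := H k.-1; have := depthE t i; have := depthE s i.
have [ki|ki|ki] := ltngtP k i; case: (eqVneq k i.+1) => k1; rewrite ?k1 ?ki /=; lia.
Qed.

(** This is the order-theoretic counterpart of the recursion for evaluations: the two alternatives
    match its two terms. *)
Lemma dominated_ins_hi_split n (i : 'I_n) (t : 'S_n.+1) (s : 'S_n) :
  noncrossing_perm t -> dominated t (ins_hi i s) ->
  dominated t (ins_lo i s) \/
  exists t', [/\ t = ins_hi i t', noncrossing_perm t', dominated t' s
               & (i <= t' i) = (i <= s i)].
Proof.
move=> nc dom.
have [/andP[le0 le1]|nle] :=
    boolP ((i <= t (ins_pos false i)) && (t (ins_pos true i) <= i)).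
  have [t' et nct'] := ins_hiP nc le0 le1.
  move: dom; rewrite et dominated_ins_hi => dom.
  have [e|ne] := eqVneq (i <= t' i) (i <= s i); first by right; exists t'.
  by left; apply: dominated_ins_hi_lo.
left; move: dom => /dominatedP H; apply/dominatedP => k.
have := H k; have := H i; have := H i.+1; rewrite !gap_ins_hi !depth_ins_hi.
rewrite gap_ins_lo depth_ins_lo.
(* The equations [a], [b], [c] are the consecutive steps of the profile of [t] from [gap t i] to
   [depth t i.+1]. By [nle], step [a] is flat or step [c] rises; either keeps [t] below the middle
   entries of [ins_lo i s]. *)
have a : depth t i = gap t i + (i <= t (ins_pos false i)).
  by have := depthE t (ins_pos false i); rewrite ins_posE addn0.
have b : depth t i = gap t i.+1 + ((t^-1)%g (ins_pos false i) < i.+1).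
  by have := rank_recr t (ins_pos false i) i.+1; rewrite ins_posE addn0.
have c : depth t i.+1 = gap t i.+1 + (i.+1 <= t (ins_pos true i)).
  by have := depthE t (ins_pos true i); rewrite ins_posE addn1.
have d := depthE s i.
rewrite ltnn leqnn !eqxx ltnNge leqnSn /= (gtn_eqF (ltnSn i)).
have [ki|ki|ki] := ltngtP k i; case: (eqVneq k i.+1) => k1; rewrite ?k1 ?ki /=; lia.
Qed.

(** * Codes of noncrossing permutations *)

Lemma porbit_ind n (s : 'S_n) (A : pred 'I_n) x y :
  A x -> (forall z, A z -> A (s z)) -> y \in porbit s x -> A y.
Proof.
move=> Ax As /porbitP[k ->]; elim: k => [|k IH]; first by rewrite expg0 perm1.
by rewrite expgSr permM; apply: As.
Qed.

Lemma porbit_next n (s : 'S_n) x y : y \in porbit s x -> s y \in porbit s x.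
Proof. by move=> /porbitP[k ->]; rewrite -permM -expgSr mem_porbit. Qed.

Lemma card_porbit_fix n (s : 'S_n) x : s x = x -> #|porbit s x| = 1.
Proof.
move=> sx; rewrite -(cards1 x); congr #|pred_of_set _|; apply/setP => y.
rewrite inE; apply/idP/eqP => [|->]; last exact: porbit_id.
by move=> yx; apply/eqP; apply: (@porbit_ind _ s (pred1 x) x) => //= z /eqP->; rewrite sx.
Qed.

Lemma rank_gt0P n (s : 'S_n) p q :
  reflect (exists2 a : 'I_n, a < p & q <= s a) (0 < rank s p q).
Proof.
rewrite lt0n /rank sum_nat_eq0 negb_forall.
apply: (iffP existsP) => [[a]|[a ap qa]]; last by exists a; rewrite ap qa.
by rewrite implyTb eqb0 negbK => /andP[ap qa]; exists a.
Qed.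

Lemma porbit_interval n (s : 'S_n) (x y z : 'I_n) : noncrossing_perm s ->
  x <= y <= s x -> z \in porbit s y -> x <= z <= s x.
Proof.
move=> [_ H] xy; apply: (@porbit_ind _ s (fun z : 'I_n => x <= z <= s x)) => // u.
by move=> /andP[]; apply: H.
Qed.

Lemma porbit_min n (s : 'S_n) (i j : 'I_n) : noncrossing_perm s ->
  i <= s i -> j \in porbit s i -> i <= j.
Proof.
move=> nc le ji; have H : i <= i <= s i by rewrite leqnn.
by have /andP[] := porbit_interval nc H ji.
Qed.

(** With gap 0 no arc leads from below [k] to [k] or above, so the points below [k] form a union of
    cycles. *)
Lemma porbit_gap0 n (s : 'S_n) k (x y : 'I_n) :
  gap s k = 0 -> x < k -> y \in porbit s x -> y < k.
Proof.
move=> g0 xk; apply: (@porbit_ind _ s (fun z : 'I_n => z < k)) => // z zk.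
rewrite ltnNge; apply/negP => kz.
by have : 0 < gap s k by [apply/rank_gt0P; exists z]; rewrite g0.
Qed.

Lemma gap_gt0 n (s : 'S_n) (i : 'I_n) : s i < i -> 0 < gap s i.
Proof.
move=> si; rewrite lt0n; apply/eqP => g0.
suff : i < i by rewrite ltnn.
apply: (porbit_gap0 g0 si); rewrite porbit_sym.
by apply: porbit_next; apply: porbit_id.
Qed.

(** The block minima are the points with [i <= s i], and the block of such a point is nested exactly
    when some block straddles the gap at [i]. *)
Lemma nc_codeE n (s : 'S_n) (i : 'I_n) : noncrossing_perm s ->
  nc_code s i = if i <= s i then #|porbit s i| - (gap s i == 0) else 0.
Proof.
move=> nc; rewrite /nc_code; set B := porbit s i.
have -> : [forall j in B, i <= j] = (i <= s i).
  apply/forall_inP/idP => [H|le j jB].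
    by apply: H; apply: porbit_next; apply: porbit_id.
  exact: porbit_min jB.
case: ifP => // le.
have minB j : j \in B -> i <= j by apply: porbit_min.
suff -> : [exists C in porbits s, (C != B) && nested B C] = (gap s i != 0).
  by case: eqP; rewrite ?subn0.
rewrite -lt0n; apply/exists_inP/idP => [[C CP /andP[_ nst]]|/rank_gt0P[a ai ia]].
  have {CP} [z _ eC] := imsetP CP.
  have [c cC /exists_inP[c' c'C /forall_inP cB]] := exists_inP nst.
  have /andP[ci ic'] := cB _ (porbit_id s i).
  rewrite lt0n; apply/eqP => g0.
  suff : c' < i by lia.
  apply: (porbit_gap0 g0 ci).
  by rewrite -eq_porbit_mem in cC *; move: cC c'C; rewrite eC -!eq_porbit_mem => /eqP-> /eqP->.
(* As [a < i <= s a], the arc from [a] spans its block, from minimum to maximum, and encloses the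
   block of [i]. *)
exists (porbit s a); first by apply: imset_f.
have aNB : a \notin B by apply/negP => /minB; lia.
apply/andP; split.
  by apply: contraNneq aNB => <-; apply: porbit_id.
apply/exists_inP; exists a; first exact: porbit_id.
apply/exists_inP; exists (s a); first by apply: porbit_next; apply: porbit_id.
apply/forall_inP => b bB; have ib := minB _ bB.
have : a <= b <= s a by apply: (porbit_interval nc _ bB); lia.
have : b != s a.
  apply: contraNneq aNB => e; rewrite -eq_porbit_mem; move: bB; rewrite -eq_porbit_mem => /eqP <-.
  by rewrite e eq_porbit_mem; rewrite porbit_sym; apply: porbit_next; apply: porbit_id.
by rewrite -(inj_eq val_inj) /=; lia.
Qed.

(** For [b = true] the new point is spliced into the cycle of [i] just before [i]; for [b = false]
    it is a separate fixed point. *)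
Lemma card_porbit_ins b n (i x : 'I_n) (s : 'S_n) :
  #|porbit (ins b i s) (lift (ins_pos b i) x)|
  = #|porbit s x| + (b && (i \in porbit s x)).
Proof.
set t := ins b i s; set e := lift (ins_pos b i).
have e_inj : injective e by apply: lift_inj.
have te z : ~~ (b && (s z == i)) -> t (e z) = e (s z).
  move=> H; apply: val_inj; rewrite /= ins_lift /= !ins_posE /bump.
  by move: H; rewrite -(inj_eq val_inj) /=; case: (b) => /=; lia.
have te' z : b && (s z == i) -> t (e z) = ins_pos b i.
  move=> /andP[b1 /eqP sz]; apply: val_inj; rewrite /= ins_lift sz ins_posE b1 /bump; lia.
have tp : b -> t (ins_pos b i) = e i.
  by move=> b1; apply: val_inj; rewrite /= ins_at ins_posE b1 /bump; lia.
have -> : porbit t (e x) = (if b && (i \in porbit s x) then [set ins_pos b i] else set0)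
                           :|: e @: porbit s x.
  apply/setP => y; apply/idP/setUP; last first.
    have ep z : z \in porbit s x -> e z \in porbit t (e x).
      apply: (@porbit_ind _ s (fun z => e z \in porbit t (e x))); first exact: porbit_id.
      move=> u /porbit_next; case: (boolP (b && (s u == i))) => [H|/te -> //].
      rewrite (te' _ H) => /porbit_next; have [b1 /eqP->] := andP H.
      by rewrite tp.
    case=> [|/imsetP[z zx ->]]; last exact: ep.
    case: ifP; rewrite !inE // => /andP[b1 ix] /eqP->.
    have /porbitP[k ek] := ep _ ix.
    have : t (ins_pos b i) \in porbit t (ins_pos b i) by apply/porbit_next/porbit_id.
    by rewrite (tp b1) porbit_sym -!eq_porbit_mem => /eqP->; rewrite eq_porbit_mem ep.
  move=> yx; apply/setUP.
  apply: (@porbit_ind _ t (fun z => z \in _ :|: _) (e x) y) => //=.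
    by apply/setUP; right; apply: imset_f; apply: porbit_id.
  move=> z /setUP[zp|/imsetP[u ux ->]]; apply/setUP.
    move: zp; case: ifP; rewrite !inE // => /andP[b1 ix] /eqP->.
    by right; rewrite tp // imset_f.
  case: (boolP (b && (s u == i))) => [H|/te ->].
    left; rewrite (te' _ H); have [b1 /eqP su] := andP H.
    by rewrite b1 -su porbit_next //= su inE.
  by right; apply: imset_f; apply: porbit_next.
rewrite cardsU card_imset // addnC.
rewrite [X in _ - #|pred_of_set X|](_ : _ = set0); last first.
  apply/setP => y; rewrite inE in_set0; apply/negP => /andP[yp /imsetP[z _ ey]].
  move: yp; rewrite ey; case: ifP => _; rewrite inE //.
  by rewrite eq_sym (negbTE (neq_lift _ _)).
by rewrite cards0 subn0; case: ifP; rewrite ?cards1 ?cards0.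
Qed.

(** If [i <= s i], doubling enlarges the block with minimum [i]. If [s i < i], the new fixed point
    is a nested block with entry 1, where the old [i] had 0. The formula mirrors
    [fcontract_code]. *)
Lemma nc_code_ins_hi n (i j : 'I_n) (s : 'S_n) : noncrossing_perm s ->
  nc_code (ins_hi i s) (lift (ins_pos true i) j) = nc_code s j + (j == i).
Proof.
move=> nc; have nct : noncrossing_perm (ins_hi i s) by apply/noncrossing_ins.
rewrite !nc_codeE // lift_ins_posE gap_ins_hi.
have -> : (if bump (i + true) j <= i then gap s (bump (i + true) j)
           else if bump (i + true) j == i.+1 then depth s i
           else gap s (bump (i + true) j).-1) = gap s j.
  rewrite /bump addn1; case: (ltnP i j) => ij /=; last by rewrite add0n ij.
  by rewrite add1n leqNgt ltnS (ltnW ij) eqSS gtn_eqF.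
rewrite /ins_hi; case: (leqP i (s i)) => si.
  rewrite ins_lift card_porbit_ins /=.
  have -> : (bump (i + 1) j <= bump i (s j)) = (j <= s j) by rewrite /bump; lia.
  case: ifP => sj; last first.
    by case: eqP => // e; move: sj; rewrite e si.
  have -> : (i \in porbit s j) = (j == i).
    apply/idP/eqP => [ij|->]; last exact: porbit_id.
    have := porbit_min nc sj ij; rewrite porbit_sym in ij.
    by have := porbit_min nc si ij; move=> h1 h2; apply: val_inj => /=; lia.
  have : 0 < #|porbit s j| by rewrite lt0n card_porbit_neq0.
  by move: #|_| => c; case: (j == i); case: (gap s j == 0); lia.
have [->|ji] := eqVneq j i.
  rewrite lift_ins_pos.
  have fix_i : ins false i s (ins_pos false i) = ins_pos false i.
    by apply: val_inj; rewrite /= ins_at.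
  rewrite fix_i card_porbit_fix // [i <= s i]leqNgt si.
  have := gap_gt0 si; rewrite lt0n => /negbTE->.
  by rewrite ins_posE /bump; case: ifP => //=; lia.
have ep : lift (ins_pos true i) j = lift (ins_pos false i) j.
  by apply: val_inj; move: ji; rewrite -(inj_eq val_inj) /= /bump /=; lia.
rewrite ep ins_lift card_porbit_ins /= !addn0.
by have -> : (bump (i + 1) j <= bump i (s j)) = (j <= s j);
  first by move: ji; rewrite -(inj_eq val_inj) /bump /=; lia.
Qed.

Lemma nc_code_ins_hi_next n (i : 'I_n) (s : 'S_n) : noncrossing_perm s ->
  nc_code (ins_hi i s) (ins_pos true i) = 0.
Proof.
move=> nc; have nct : noncrossing_perm (ins_hi i s) by apply/noncrossing_ins.
rewrite nc_codeE // ins_posE /ins_hi; case: (leqP i (s i)) => si.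
  by rewrite ins_at addn1 ltnn.
have := ins_atN false i s; rewrite [~~ _]/= => ->.
by rewrite /bump; case: ifP => //; lia.
Qed.

(** It suffices to exclude that [i+1] is a block minimum. If it were, code 0 would make its block
    not nested, so no arc would cross the gap at [i+1] and [i] would be fixed. Its positive code
    then needs an arc from some [a < i] that ends at [i], against injectivity. *)
Lemma ins_hi_of_code n (i : 'I_n) (t : 'S_n.+1) : noncrossing_perm t ->
  0 < nc_code t (ins_pos false i) -> nc_code t (ins_pos true i) = 0 ->
  exists2 s, t = ins_hi i s & noncrossing_perm s.
Proof.
move=> nc; rewrite !nc_codeE // !ins_posE addn0 addn1.
case: ifP => // le0 c0 c1; apply: ins_hiP => //.
rewrite leqNgt; apply/negP => lt1; move: c1; rewrite lt1 => c1.
have g1 : gap t i.+1 = 0.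
  apply/eqP; apply: contraT => g1; move: c1; rewrite (negbTE g1) subn0 => /eqP.
  by rewrite (negbTE (card_porbit_neq0 _ _)).
have le (a : 'I_n.+1) : a < i.+1 -> t a <= i.
  move=> ai; rewrite leqNgt; apply/negP => ta.
  by have : 0 < gap t i.+1 by [apply/rank_gt0P; exists a]; rewrite g1.
have e0 : t (ins_pos false i) = ins_pos false i.
  by apply: val_inj; have := le (ins_pos false i); rewrite /= in le0 *; lia.
move: c0; rewrite card_porbit_fix //; case: eqP => // /eqP.
rewrite -lt0n => /rank_gt0P[a ai ia] _.
have ea : t a = ins_pos false i.
  by apply: val_inj; have := le a; rewrite /=; lia.
move: ea; rewrite -e0 => /perm_inj ea.
by move: ai; rewrite ea ins_posE; lia.
Qed.

Lemma nc_code_eq0 n (t : 'S_n) : noncrossing_perm t ->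
  (forall i, nc_code t i = 0) <-> t = 1%g.
Proof.
move=> nc; split=> [z|-> i].
  case: n t nc z => [|n] t nc z; first by apply/permP => -[].
  apply/eqP; apply: contraT => /(noncrossing_ins_hi nc)[i [s [et ncs]]].
  by have := z (lift (ins_pos true i) i); rewrite et nc_code_ins_hi // eqxx addn1.
rewrite nc_codeE; last first.
  by split=> x y; rewrite !perm1; lia.
rewrite perm1 leqnn card_porbit_fix ?perm1 // (_ : gap _ _ = 0) //.
by apply: big1 => a _; rewrite perm1; lia.
Qed.

(** * Evaluations of double forest polynomials *)

Definition ev_arg n (s : 'S_n) (t : nat -> rat) : nat -> rat :=
  fun j => if insub j is Some k then t (s k : nat) else t j.

Lemma ev_arg_ord n (s : 'S_n) t (k : 'I_n) : ev_arg s t k = t (s k).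
Proof. by rewrite /ev_arg valK. Qed.

Lemma ev_arg_ge n (s : 'S_n) t j : n <= j -> ev_arg s t j = t j.
Proof. by move=> nj; rewrite /ev_arg insubF // ltnNge nj. Qed.

Lemma thatE i t j : that i t j = t (bump i j).
Proof. by rewrite /that /bump; case: leqP. Qed.

Lemma ins_posP b n (i : 'I_n) (u : 'I_n.+1) :
  (exists k : 'I_n, u = lift (ins_pos b i) k) \/ u = ins_pos b i.
Proof. by case: (unliftP (ins_pos b i) u) => [k|] ->; [left; exists k|right]. Qed.

(** Omitting [t i] renumbers the values by [bump i]; putting [t i] back at position [i+1] creates
    the new point, sent to [i]. *)
Lemma Rplus_arg_ev n (i : 'I_n) (s : 'S_n) t :
  Rplus_arg i (ev_arg s (that i t)) t =1 ev_arg (ins true i s) t.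
Proof.
move=> j; have [jn|nj] := ltnP j n.+1; last first.
  rewrite ev_arg_ge // /Rplus_arg; have := ltn_ord i => lt_i.
  do 2![case: ifP => [|_]; first lia].
  by rewrite ev_arg_ge ?thatE /bump; [congr t; lia|lia].
rewrite -[j]/(nat_of_ord (Ordinal jn)) ev_arg_ord.
case: (ins_posP true i (Ordinal jn)) => [[k ->]|->].
  rewrite ins_lift lift_ins_posE /Rplus_arg /bump addn1.
  case: (ltnP i k) => ik /=; last by rewrite add0n ik ev_arg_ord thatE.
  do 2![case: ifP => [|_]; first lia].
  by rewrite ev_arg_ord thatE.
by rewrite ins_at ins_posE /Rplus_arg addn1 ltnn eqxx.
Qed.

Lemma Rminus_arg_ev n (i : 'I_n) (s : 'S_n) t :
  Rminus_arg i (ev_arg s (that i t)) t =1 ev_arg (ins false i s) t.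
Proof.
move=> j; have [jn|nj] := ltnP j n.+1; last first.
  rewrite ev_arg_ge // /Rminus_arg; have := ltn_ord i => lt_i.
  do 2![case: ifP => [|_]; first lia].
  by rewrite ev_arg_ge ?thatE /bump; [congr t; lia|lia].
rewrite -[j]/(nat_of_ord (Ordinal jn)) ev_arg_ord.
case: (ins_posP false i (Ordinal jn)) => [[k ->]|->].
  rewrite ins_lift lift_ins_posE /Rminus_arg /bump addn0.
  case: (ltnP k i) => ik /=; first by rewrite add0n ik ev_arg_ord thatE.
  do 2![case: ifP => [|_]; first lia].
  by rewrite ev_arg_ord thatE.
by rewrite ins_at ins_posE /Rminus_arg addn0 ltnn eqxx.
Qed.

(** For polynomials this takes the place of functional extensionality. *)
Lemma homog_poly_ext f x x' t : homog_poly f -> x =1 x' -> f x t = f x' t.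
Proof.
case=> N [d [p [_ fE]]] xx'; rewrite !fE; apply: meval_eq => k.
by case: ifP => // _; rewrite xx'.
Qed.

Local Open Scope ring_scope.

Lemma ev_ins P n (i : 'I_n) (s : 'S_n) F t : is_double_forest_family P ->
  ev (ins true i s) (P F) t - ev (ins false i s) (P F) t
  = (t (bump i (s i)) - t i)
    * (if nat_of_ord i \in Qdes F then ev s (P (fcontract F i)) (that i t) else 0).
Proof.
case=> hom _ rec; have := rec F i (ev_arg s (that i t)) t.
rewrite /Rplus /Rminus (homog_poly_ext _ (hom F) (Rplus_arg_ev i s t)).
rewrite (homog_poly_ext _ (hom F) (Rminus_arg_ev i s t)).
rewrite ev_arg_ord thatE /ev -/(ev_arg _ _).
by case: ifP => _ ->; rewrite ?subrr ?mulr0.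
Qed.

Definition increasing (t : nat -> rat) := forall i j, (i < j)%N -> t i < t j.

Lemma increasing_that i t : increasing t -> increasing (that i t).
Proof. by move=> inc j k jk; rewrite !thatE; apply: inc; rewrite /bump; lia. Qed.

(** For [s i < i] the two insertions exchange roles and the factor changes sign with them. The
    equation holds for every [t], as the vanishing case requires; monotonicity of [t] only fixes the
    sign of [c]. *)
Lemma ev_ins_hi P n (i : 'I_n) (s : 'S_n) F t : is_double_forest_family P ->
  exists2 c, increasing t -> 0 < c &
    ev (ins_hi i s) (P F) t = ev (ins_lo i s) (P F) t
      + c * (if nat_of_ord i \in Qdes F then ev s (P (fcontract F i)) (that i t) else 0).
Proof.
move=> HP; have := ev_ins i s F t HP; rewrite /ins_hi /ins_lo.
case: (leqP i (s i)) => si /= /eqP; rewrite subr_eq => /eqP E.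
  exists (t (bump i (s i)) - t i); last by rewrite E addrC.
  by move=> inc; rewrite subr_gt0; apply: inc; rewrite /bump; lia.
exists (t i - t (bump i (s i))).
  by move=> inc; rewrite subr_gt0; apply: inc; rewrite /bump; lia.
by rewrite E addrAC -mulrDl addrA subrK subrr mul0r add0r.
Qed.

Lemma ev1 P n F t : is_double_forest_family P ->
  ev (1 : 'S_n)%g (P F) t = if forest_empty F then 1 else 0.
Proof.
case=> hom PP _; rewrite -(PP F t); apply: (homog_poly_ext _ (hom F)) => j.
by case: insubP => // k _ <-; rewrite perm1.
Qed.

Local Close Scope ring_scope.

(** The second clause expresses the support condition in a form that passes to [fcontract F i]. *)
Definition has_code n (F : forest) (tau : 'S_n) : Prop :=
  (forall i : 'I_n, fcode F i = nc_code tau i) /\ (forall i, n <= i -> fcode F i = 0).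

(** Contracting the forest and undoing the insertion delete the same entry of the code and lower the
    entry at [i] by the same unit. *)
Lemma has_code_ins_hi n (i : 'I_n) (s : 'S_n) F :
  noncrossing_perm s -> has_code F (ins_hi i s) ->
  (nat_of_ord i \in Qdes F) /\ has_code (fcontract F i) s.
Proof.
move=> nc [codeF code0].
have cF (j : 'I_n) : fcode F (bump i.+1 j) = nc_code s j + (j == i).
  by rewrite -(nc_code_ins_hi i j nc) -codeF lift_ins_posE addn1.
have iQ : nat_of_ord i \in Qdes F.
  have := cF i; rewrite eqxx /bump ltnn add0n addn1 QdesE => ->.
  have := codeF (ins_pos true i); rewrite nc_code_ins_hi_next // ins_posE addn1 => ->.
  by [].
split=> //; split=> [j|j nj].
  have := fcontract_code j iQ; rewrite cF (inj_eq val_inj).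
  exact: addIn.
have := fcontract_code j iQ; rewrite code0; last by rewrite /bump; have := ltn_ord i; lia.
by lia.
Qed.

Lemma Qdes_has_code n (i : 'I_n) (t : 'S_n.+1) F :
  noncrossing_perm t -> has_code F t -> nat_of_ord i \in Qdes F ->
  exists2 s, t = ins_hi i s & noncrossing_perm s.
Proof.
move=> nc [codeF _]; rewrite QdesE => /andP[c0 /eqP c1].
by apply: ins_hi_of_code => //; rewrite -codeF ins_posE ?addn0 ?addn1.
Qed.

Lemma has_code1 n (tau : 'S_n) F : noncrossing_perm tau -> has_code F tau ->
  dominated tau 1%g = forest_empty F.
Proof.
move=> nc [codeF code0]; apply/idP/forest_emptyP => [/dominated1 t1 i|z].
  have [lt_i|] := ltnP i n; last exact: code0.
  by have := codeF (Ordinal lt_i); rewrite (nc_code_eq0 nc).2.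
have -> : tau = 1%g by apply/(nc_code_eq0 nc) => i; rewrite -codeF z.
by apply: bruhat_dominated; apply: rt_refl.
Qed.

(** * Vanishing and positivity of the evaluations *)

Lemma ev_dominated1 P n (tau : 'S_n) F :
  is_double_forest_family P -> noncrossing_perm tau -> has_code F tau ->
  if dominated tau 1%g
  then bruhat_le tau 1%g /\ forall t, increasing t -> (0 < ev (1 : 'S_n)%g (P F) t)%R
  else forall t, ev (1 : 'S_n)%g (P F) t = 0%R.
Proof.
move=> HP nc codeF; case: ifP => d1; last first.
  by move=> t; rewrite ev1 // -(has_code1 nc codeF) d1.
split=> [|t _]; last by rewrite ev1 // -(has_code1 nc codeF) d1.
by rewrite (dominated1 d1); apply: rt_refl.
Qed.

(** Induction on [n], then on the length of [sigma]: [ins_lo i s] is shorter and [s] has one point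
    less. Carrying the Bruhat relation along identifies it with domination. *)
Lemma ev_dominated P n (sigma tau : 'S_n) F :
  is_double_forest_family P ->
  noncrossing_perm sigma -> noncrossing_perm tau -> has_code F tau ->
  if dominated tau sigma
  then bruhat_le tau sigma /\ forall t, increasing t -> (0 < ev sigma (P F) t)%R
  else forall t, ev sigma (P F) t = 0%R.
Proof.
move=> HP; elim: n sigma tau F => [|n IHn] sigma tau F; have [m] := ubnP (perm_length sigma);
  elim: m sigma tau F => // m IHm sigma tau F lt_m ncs nct codeF.
- have -> : sigma = 1%g by apply/permP => -[].
  exact: ev_dominated1.
have [->|sN1] := eqVneq sigma 1%g; first exact: ev_dominated1.
have [i [s [es ncs']]] := noncrossing_ins_hi ncs sN1.
have step := bruhat_step_ins i s.
have len_lo : perm_length (ins_lo i s) < m.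
  by case: step => x [y [_ _ lt]]; rewrite es in lt_m; apply: leq_trans lt _.
have nc_lo : noncrossing_perm (ins_lo i s) by apply/noncrossing_ins.
have {IHm len_lo nc_lo} lo := IHm _ _ _ len_lo nc_lo nct codeF.
have contr (t' : 'S_n) : tau = ins_hi i t' -> noncrossing_perm t' ->
    (nat_of_ord i \in Qdes F) /\ (if dominated t' s
      then bruhat_le t' s /\
        forall t, increasing t -> (0 < ev s (P (fcontract F i)) t)%R
      else forall t, ev s (P (fcontract F i)) t = 0%R).
  move=> et nct'; rewrite et in codeF; have [iQ codeF'] := has_code_ins_hi nct' codeF.
  by split=> //; apply: IHn.
have lo_ge0 t : increasing t -> (0 <= ev (ins_lo i s) (P F) t)%R.
  by move=> inc; move: lo; case: ifP => _ => [[_ H]|->] //; apply: ltW; apply: H.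
have contr_ge0 t : increasing t ->
    (0 <= if nat_of_ord i \in Qdes F then ev s (P (fcontract F i)) t else 0)%R.
  move=> inc; case: ifP => // iQ; have [t' et nct'] := Qdes_has_code nct codeF iQ.
  by have [_] := contr _ et nct'; case: ifP => _ => [[_ H]|->] //; apply: ltW; apply: H.
(* Without domination both terms of [ev_ins_hi] vanish by induction. *)
rewrite es; case: ifP => dom; last first.
  have dlo : dominated tau (ins_lo i s) = false.
    apply: contraFF dom => /dominated_trans; apply.
    by apply: bruhat_dominated; apply: rt_step.
  move=> t; have [c _ ->] := ev_ins_hi i s F t HP.
  rewrite dlo in lo; rewrite lo add0r; case: ifP => [iQ|_]; last by rewrite mulr0.
  have [t' et nct'] := Qdes_has_code nct codeF iQ.
  have [_] := contr _ et nct'.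
  by rewrite -(dominated_ins_hi i) -et dom => ->; rewrite mulr0.
(* With domination one of the two terms is positive and the other nonnegative. *)
have [dlo|[t' [et nct' dom' eb]]] := dominated_ins_hi_split nct dom.
  rewrite dlo in lo; have [le_lo pos_lo] := lo; split.
    by apply: rt_trans le_lo _; apply: rt_step.
  move=> t inc; have [c /(_ inc) c0 ->] := ev_ins_hi i s F t HP.
  apply: ltr_wpDr; last exact: pos_lo.
  by apply: mulr_ge0; [exact: ltW|apply: contr_ge0; exact: increasing_that].
have [iQ] := contr _ et nct'; rewrite dom' => -[le_s pos_s]; split.
  (* By [eb] both permutations receive the new point at the same position, so the Bruhat relation
     lifts. *)
  by rewrite et /ins_hi eb; apply: bruhat_lift.
move=> t inc; have [c /(_ inc) c0 ->] := ev_ins_hi i s F t HP.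
rewrite iQ; apply: ltr_wpDl; first exact: lo_ge0.
by apply: mulr_gt0 => //; apply: pos_s; apply: increasing_that.
Qed.

Theorem theorem8p14 (P : forest -> pfun) (HP : is_double_forest_family P)
  (n : nat) (sigma : 'S_n) (F : forest) (tau : 'S_n) :
  is_NC sigma ->
  all (fun i => (i < n)%N) (supp F) ->
  ForToNC_is F tau ->
  ((forall t, ev sigma (P F) t = 0%R) <-> ~ bruhat_le tau sigma).
Proof.
move=> /is_NC_noncrossing_perm ncs suppF [/is_NC_noncrossing_perm nct codeF].
have code_tau : has_code F tau.
  split=> // i ni; apply: eq0_ngt0 => /fcode_supp /(allP suppF).
  by rewrite ltnNge ni.
have := ev_dominated HP ncs nct code_tau; case: ifP => [_ [le pos]|dom zero].
  (* The increasing sequence [t k = k] witnesses that the evaluation is not identically zero. *)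
  split=> [zero|//]; have inc : increasing (fun k => k%:R)%R.
    by move=> i j; rewrite ltr_nat.
  by have := pos _ inc; rewrite zero ltxx.
by split=> // _ /bruhat_dominated; rewrite dom.
Qed.
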